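(* Let $(P,\preceq)$ be a finite poset, let $Q=\mathcal{O}(P,\preceq,\preceq)$ be the associated double order polytope, and let $D$ be the dimension of $Q$. Then $f_0(Q)f_{D-1}(Q)\leq D2^{D+1}$, and equality holds if and only if $Q$ is affinely isomorphic to the $D$-dimensional cube or the $D$-dimensional cross-polytope.
   Context: For a $D$-dimensional polytope $Q$, $f_0(Q)$ is its number of vertices and $f_{D-1}(Q)$ its number of facets. The $D$-dimensional cube is $[-1,1]^D$ and the $D$-dimensional cross-polytope is its polar. For a finite poset $(P,\preceq)$ the order polytope is $\mathcal{O}(P)=\{x\in[0,1]^P: x_i\geq x_j\text{ whenever }i\preceq j\}$. For two partial orders $\preceq_+,\preceq_-$ on the same set $P$, with $P_+=(P,\preceq_+)$ and $P_-=(P,\preceq_-)$, the double order polytope is $$\mathcal{O}(P,\preceq_+,\preceq_-)=\mathrm{conv}\{(2\mathcal{O}(P_+)\times\{1\})\cup(-2\mathcal{O}(P_-)\times\{-1\})\}\subseteq\mathbb{R}^P\times\mathbb{R}.$$ *)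

(* Defs.v *)
From HB Require Import structures.
From mathcomp Require Import all_boot all_order all_algebra finmap.
From mathcomp Require Import boolp classical_sets functions cardinality reals.

Set Implicit Arguments.
Unset Strict Implicit.
Unset Printing Implicit Defensive.

Import Order.TTheory GRing.Theory Num.Theory.

Local Open Scope classical_set_scope.
Local Open Scope ring_scope.

Section Polytopes.
Context {R : realType}.

Definition conv_hull (V : lmodType R) (A : set V) : set V :=
  [set x | exists (n : nat) (a : 'I_n -> R) (v : 'I_n -> V),
    [/\ forall i, 0 <= a i, \sum_i a i = 1, forall i, A (v i)
      & x = \sum_i a i *: v i]].

Definition aff_hull (V : lmodType R) (A : set V) : set V :=
  [set x | exists (n : nat) (a : 'I_n -> R) (v : 'I_n -> V),
    [/\ \sum_i a i = 1, forall i, A (v i) & x = \sum_i a i *: v i]].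

(* The affine hull of a nonempty set is a translate x + U of exactly one linear
   subspace U, and [dimension A] is the linear dimension of U.  The empty set
   gets the default value 0 (instead of the customary -1); this is why [faces]
   below requires its members to be nonempty. *)
Definition dimension (V : vectType R) (A : set V) : nat :=
  get [set d : nat | exists (x : V) (U : {vspace V}),
    aff_hull A = [set x + u | u in [set u | u \in U]] /\ \dim U = d].

Definition is_face (V : vectType R) (Q F : set V) : Prop :=
  exists (l : 'Hom(V, R^o)) (c : R),
    (forall x, Q x -> l x <= c) /\ F = Q `&` [set x | l x = c].

Definition faces (V : vectType R) (k : nat) (Q : set V) : set (set V) :=
  [set F | [/\ is_face Q F, F !=set0 & dimension F = k]].

(* [fset_set] sends an infinite set to the empty one; this default is not
   reached when Q is a polytope, as a polytope has finitely many faces. *)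
Definition f_ (V : vectType R) (k : nat) (Q : set V) : nat :=
  #|` fset_set (faces k Q)|.

Definition aff_isomorphic (V W : vectType R) (A : set V) (B : set W) : Prop :=
  exists (h : 'Hom(V, W)) (b : W), set_bij A B (fun x => h x + b).

Definition cube (D : nat) : set 'rV[R]_D :=
  [set x | forall i, -1 <= x 0 i <= 1].

Definition polar (D : nat) (A : set 'rV[R]_D) : set 'rV[R]_D :=
  [set y | forall x, A x -> \sum_i x 0 i * y 0 i <= 1].

Definition cross_polytope (D : nat) : set 'rV[R]_D := polar (@cube D).

(* The regular module R^o is R seen as a vector space over itself. *)
Definition order_polytope (P : finType) (le : rel P) : set {ffun P -> R^o} :=
  [set x | (forall i, 0 <= x i <= 1) /\ (forall i j, le i j -> x j <= x i)].

Definition double_order_polytope (P : finType) (le_p le_m : rel P) :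
    set ({ffun P -> R^o} * R^o)%type :=
  conv_hull ([set (2 *: x, 1) | x in order_polytope le_p] `|`
             [set (- 2 *: x, -1) | x in order_polytope le_m]).

End Polytopes.

Arguments cube : clear implicits.
Arguments cross_polytope : clear implicits.
Arguments order_polytope : clear implicits.
Arguments double_order_polytope : clear implicits.

(* Main.v *)
Require Import Defs.
From HB Require Import structures.
From mathcomp Require Import all_boot all_order all_algebra finmap.
From mathcomp Require Import boolp classical_sets functions cardinality reals.
From mathcomp Require Import zify lra.

Set Implicit Arguments.
Unset Strict Implicit.
Unset Printing Implicit Defensive.

Import Order.TTheory GRing.Theory Num.Theory.

(** Let [n] be the cardinality of [P].  To a down-set [I] attach the point
[w_I = (2 1_I, 1)], and to a chain [C = {c_1 < ... < c_k}] the functional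
[l_C (x, t) = t - x_(c_1) + x_(c_2) - ...].  A down-set meets a chain in an
initial segment, so [l_C (w_I)] is always [1] or [-1].

The double order polytope [Q] is at the same time the convex hull of the points
[w_I] and [- w_I] and the set of points [z] where [`|l_C z| <= 1] for every chain
[C] ([double_order_hull], [double_order_ineq]).  The only inclusion that needs
an idea is that these inequalities suffice.  Given such a point [(x, t)], let
[u p] and [v p] be the largest alternating sums of [x] and of [- x] along chains
above [p].  This is a Jordan decomposition: [u] and [v] are order reversing,
[x = u - v], and the inequalities say precisely that [u <= 1 + t] and
[v <= 1 - t] ([upper_variation_sub], [ineq_signed_hull]).  Slicing [u] and [v]
along their level sets, which are down-sets, writes [(x, t)] as a convex
combination of the [w_I] and [- w_I].

For a full-dimensional polytope presented in these two ways with all values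
[l_C (w_I)] equal to [1] or [-1], every [w_I] and [- w_I] is a vertex and every
[l_C] and [- l_C] defines a facet ([two_level_vertices], [two_level_facets]).
So [D = n + 1], and if [j] and [c] are the numbers of down-sets and of chains of
[P] then [f_0 Q = 2 j] and [f_(D-1) Q = 2 c].  The number [j] is also the number
of antichains, so the inequality says that the numbers of cliques and of stable
sets of the comparability graph have a product of at most [(n + 1) 2 ^ n].  This
holds for every graph, by induction on the vertices, and equality forces every
vertex to be adjacent to all the others or to none, that is, the graph to be
complete or empty ([clique_stable_count], [clique_stable_count_eq]).

If the graph is empty, there are only [n + 1] chains, and [z |-> (l_C z)_C] maps
[Q] to the cube.  If it is complete, there are only [n + 1] down-sets, and the
basis [w_I] identifies [Q] with the cross-polytope.  Conversely, a polytope [Q]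
isomorphic to the cube (the cross-polytope) has, by affine invariance, the face
numbers of the double order polytope of an antichain (a chain) with [n]
elements, for which the product is [D 2 ^ (D + 1)]. *)

(** * Cliques and stable sets of a graph *)

(** For a symmetric [r] these are the cliques of the graph [r]; the stable sets
are the homogeneous sets of the complementary relation. *)
Definition homogeneous (T : finType) (r : rel T) (A : {set T}) : bool :=
  [forall x in A, forall y in A, (x != y) ==> r x y].

Definition homogeneous_count (T : finType) (r : rel T) (S : {set T}) : nat :=
  #|[set A : {set T} | (A \subset S) && homogeneous r A]|.

Section Homogeneous.
Variables (T : finType) (r : rel T).
Hypothesis r_sym : symmetric r.

Lemma homogeneousP (A : {set T}) :
  reflect {in A &, forall x y, x != y -> r x y} (homogeneous r A).
Proof.
apply: (iffP forallP) => [h x y xA yA xy | h x].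
  by have /implyP/(_ xA)/forallP/(_ y)/implyP/(_ yA)/implyP/(_ xy) := h x.
apply/implyP => xA; apply/forallP => y; apply/implyP => yA.
by apply/implyP; apply: h.
Qed.

Lemma homogeneous_count_le_exp (S : {set T}) :
  (homogeneous_count r S <= 2 ^ #|S|)%N.
Proof.
rewrite -card_powerset; apply/subset_leq_card/fintype.subsetP => A.
by rewrite !inE => /andP[].
Qed.

Lemma homogeneous_count_mono (S S' : {set T}) :
  S \subset S' -> (homogeneous_count r S <= homogeneous_count r S')%N.
Proof.
move=> SS'; apply/subset_leq_card/fintype.subsetP => A.
by rewrite !inE => /andP[AS ->]; rewrite (fintype.subset_trans AS SS').
Qed.

(** The homogeneous subsets of [v |: S] that contain [v] correspond to those
contained in the neighbourhood of [v]. *)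
Lemma homogeneous_countU1 (v : T) (S : {set T}) : v \notin S ->
  homogeneous_count r (v |: S) =
  (homogeneous_count r S + homogeneous_count r [set x in S | r v x])%N.
Proof.
move=> vS; rewrite /homogeneous_count.
rewrite -(cardsID [set A : {set T} | v \notin A]); congr addn.
  apply: eq_card => A; rewrite !inE; case: (boolP (v \in A)) => vA /=.
    rewrite andbF; apply/esym/negbTE; apply: contra vS => /andP[/fintype.subsetP AS _].
    exact: AS.
  rewrite andbT; congr andb; apply/idP/idP => AS;
    last exact: fintype.subset_trans AS (finset.subsetUr _ _).
  apply/fintype.subsetP => x xA; have /fintype.subsetP/(_ _ xA) := AS.
  by rewrite !inE => /orP[/eqP xv|//]; rewrite -xv xA in vA.
have inj : {in [set A : {set T} | (A \subset [set x in S | r v x]) && homogeneous r A] &,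
   injective (fun A : {set T} => v |: A)}.
  have vN (A : {set T}) : A \subset [set x in S | r v x] -> v \notin A.
    by move=> /fintype.subsetP AS; apply/negP => /AS; rewrite inE (negbTE vS).
  move=> A A'; rewrite !inE => /andP[/vN vA _] /andP[/vN vA' _] /(congr1 (fun X => X :\ v)).
  by rewrite !finset.setU1K.
rewrite -(card_in_imset inj); apply: eq_card => A; rewrite !inE negbK.
apply/idP/imsetP => [/and3P[vA AS /homogeneousP hA] | [B]].
  exists (A :\ v); last by rewrite finset.setD1K.
  rewrite inE; apply/andP; split; last first.
    apply/homogeneousP => x y; rewrite !inE => /andP[_ xA] /andP[_ yA]; exact: hA.
  apply/fintype.subsetP => x; rewrite !inE => /andP[xv xA].
  have /fintype.subsetP/(_ _ xA) := AS; rewrite !inE (negbTE xv) /= => ->.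
  by apply: hA => //; rewrite eq_sym.
rewrite inE => /andP[/fintype.subsetP BS /homogeneousP hB] ->.
rewrite !inE eqxx /=; apply/andP; split.
  by apply: finset.setUS; apply/fintype.subsetP => x /BS; rewrite inE => /andP[].
have rv x : x \in B -> r v x by move=> /BS; rewrite inE => /andP[].
apply/homogeneousP => x y; rewrite !inE.
move=> /orP[/eqP ->|xB] /orP[/eqP ->|yB]; rewrite ?eqxx //.
- by move=> _; apply: rv.
- by move=> _; rewrite r_sym; apply: rv.
- exact: hB.
Qed.

Lemma homogeneous_setT_card : (forall x y, x != y -> r x y) ->
  #|[set A : {set T} | homogeneous r A]| = (2 ^ #|T|)%N.
Proof.
move=> h; rewrite -cardsT -card_powerset; apply: eq_card => A.
by rewrite !inE finset.subsetT; apply/homogeneousP => x y _ _; apply: h.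
Qed.

Lemma homogeneous_le1_card : (forall x y, x != y -> ~~ r x y) ->
  #|[set A : {set T} | homogeneous r A]| = #|T|.+1.
Proof.
move=> h.
have -> : [set A : {set T} | homogeneous r A] = finset.set0 |: [set [set x] | x in T].
  apply/setP => A; rewrite !inE; apply/homogeneousP/idP.
    move=> hA; case: (set_0Vmem A) => [->|[x xA]]; first by rewrite eqxx.
    apply/orP; right; apply/imsetP; exists x => //.
    apply/setP => y; rewrite inE; apply/idP/eqP => [yA|->//].
    by apply/eqP; apply: contraT => yx; move: (hA _ _ yA xA yx); rewrite (negbTE (h _ _ yx)).
  move=> /orP[/eqP ->|/imsetP[x _ ->]] y z; rewrite !inE //.
  by move=> /eqP -> /eqP ->; rewrite eqxx.
rewrite cardsU1 card_imset; last exact: set1_inj.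
have -> : finset.set0 \notin [set [set x] | x in T].
  apply/imsetP => -[x _ /setP/(_ x)]; by rewrite !inE eqxx.
by rewrite cardT -cardE.
Qed.
End Homogeneous.

Section CliqueStable.
Variables (T : finType) (r : rel T).
Hypothesis r_sym : symmetric r.
Let r' : rel T := fun x y => ~~ r x y.

Let r'_sym : symmetric r'.
Proof. by move=> x y; rewrite /r' r_sym. Qed.

(** Let [i0] and [c0] count the cliques and the stable sets in [S], and [i1] and
[c1] those to which [v] can be added.  Then
[(i0 + i1) (c0 + c1) = 2 i0 c0 + 2 i1 c1 - (i0 - i1) (c0 - c1)], where
[i1 <= i0] and [c1 <= c0], while [i1 c1 <= 2 ^ #|S|] because the neighbours and
the non-neighbours of [v] partition [S].  Equality needs [i0 = i1] or
[c0 = c1]. *)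
Lemma clique_stable_step (v : T) (S : {set T}) : v \notin S ->
  (homogeneous_count r S * homogeneous_count r' S <= #|S|.+1 * 2 ^ #|S|)%N ->
  let S' := v |: S in
  (homogeneous_count r S' * homogeneous_count r' S' <= #|S'|.+1 * 2 ^ #|S'|)%N
  /\ ((homogeneous_count r S' * homogeneous_count r' S' = #|S'|.+1 * 2 ^ #|S'|)%N ->
   homogeneous_count r [set x in S | r v x] = homogeneous_count r S \/
   homogeneous_count r' [set x in S | r' v x] = homogeneous_count r' S).
Proof.
move=> vS IH S'; rewrite /S' !homogeneous_countU1 // cardsU1 vS /= add1n.
set i0 := homogeneous_count r S in IH *; set c0 := homogeneous_count r' S in IH *.
set i1 := homogeneous_count r _; set c1 := homogeneous_count r' _.
have i10 : (i1 <= i0)%N.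
  by apply: homogeneous_count_mono; apply/fintype.subsetP => x; rewrite inE => /andP[].
have c10 : (c1 <= c0)%N.
  by apply: homogeneous_count_mono; apply/fintype.subsetP => x; rewrite inE => /andP[].
have i1c1 : (i1 * c1 <= 2 ^ #|S|)%N.
  have := leq_mul (homogeneous_count_le_exp r [set x in S | r v x])
                  (homogeneous_count_le_exp r' [set x in S | r' v x]).
  rewrite -expnD; suff -> : (#|[set x in S | r v x]| + #|[set x in S | r' v x]|)%N = #|S| by [].
  rewrite -(cardsID [set x | r v x] S); congr addn; apply: eq_card => x; rewrite !inE //.
  by rewrite andbC.
rewrite expnS; set m := (2 ^ #|S|)%N in IH i1c1 *; set s := #|S| in IH *.
by split; nia.
Qed.

Lemma clique_stable_count (S : {set T}) :
  (homogeneous_count r S * homogeneous_count r' S <= #|S|.+1 * 2 ^ #|S|)%N.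
Proof.
elim: {S}#|S| {-2}S (erefl #|S|) => [S /eqP|n IH S Sn].
  rewrite cards_eq0 => /eqP ->.
  have := leq_mul (homogeneous_count_le_exp r finset.set0)
                  (homogeneous_count_le_exp r' finset.set0).
  by rewrite !cards0.
have [v vS] : exists v, v \in S by apply/card_gt0P; rewrite Sn.
have h : v \notin S :\ v by rewrite !inE eqxx.
have hn : #|S :\ v| = n by have := cardsD1 v S; rewrite vS Sn => -[].
by rewrite -(finset.setD1K vS); case: (clique_stable_step h (IH _ hn)).
Qed.

(** The family counted on the left is contained in the one counted on the right,
so that equality of the counts puts every singleton of [S] in the former. *)
Lemma homogeneous_count_eq (q : rel T) (v : T) (S : {set T}) :
  homogeneous_count q [set x in S | q v x] = homogeneous_count q S ->
  {in S, forall x, q v x}.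
Proof.
move=> e x xS.
have sub : [set A : {set T} | (A \subset [set x in S | q v x]) && homogeneous q A]
   \subset [set A : {set T} | (A \subset S) && homogeneous q A].
  apply/fintype.subsetP => A; rewrite !inE => /andP[AS ->]; rewrite andbT.
  by apply: (fintype.subset_trans AS); apply/fintype.subsetP => y; rewrite inE => /andP[].
have /(_ [set x]) := fintype.subset_cardP e sub.
have xh : homogeneous q [set x].
  by apply/homogeneousP => a b; rewrite !inE => /eqP -> /eqP ->; rewrite eqxx.
by rewrite !inE !finset.sub1set xh !andbT inE xS /= => ->.
Qed.

(** The last vertex of the induction is arbitrary, so in the equality case every
vertex is adjacent to all the others or to none of them. *)
Lemma clique_stable_count_eq :
  (homogeneous_count r [set: T] * homogeneous_count r' [set: T] =
    #|T|.+1 * 2 ^ #|T|)%N ->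
  (forall x y, x != y -> r x y) \/ (forall x y, x != y -> ~~ r x y).
Proof.
move=> e.
have dich v : (forall y, v != y -> r v y) \/ (forall y, v != y -> ~~ r v y).
  have vN : v \notin [set~ v] by rewrite !inE eqxx.
  have vT : v |: [set~ v] = [set: T] by apply/setP => x; rewrite !inE; case: eqP.
  have [_] := clique_stable_step vN (clique_stable_count _).
  rewrite vT cardsT => /(_ e)[]/homogeneous_count_eq h; [left|right] => y vy;
    by apply: h; rewrite !inE eq_sym.
have [all|] := pselect (forall v y, v != y -> r v y); first by left.
move=> /existsNP[v /existsNP[y /not_implyP[vy /negP nvy]]]; right=> a b ab.
(* [v] is adjacent to nothing, so no other vertex is adjacent to everything. *)
have vI : forall z, v != z -> ~~ r v z.
  by have [/(_ y vy)|//] := dich v; rewrite (negbTE nvy).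
case: (eqVneq v a) ab => [<- vb|va ab]; first exact: vI.
have [/(_ v)|ha] := dich a; last exact: ha.
by rewrite eq_sym => /(_ va); rewrite r_sym (negbTE (vI _ va)).
Qed.
End CliqueStable.

(** * Affine hulls and dimension *)

Section Functionals.
Local Open Scope ring_scope.
Variables (R : realType) (V : vectType R) (l : 'Hom(V, R^o)).

(** Values of a functional lie in the module [R^o]; these lemmas restate
linearity with the operations of the field [R]. *)
Lemma functionalD (x y : V) : l (x + y) = l x + l y :> R.
Proof. by rewrite linearD. Qed.

Lemma functionalZ (k : R) (x : V) : l (k *: x) = k * l x :> R.
Proof. by rewrite linearZ. Qed.

Lemma functional_sum (I : finType) (a : I -> R) (v : I -> V) :
  l (\sum_i a i *: v i) = \sum_i a i * l (v i) :> R.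
Proof. by rewrite linear_sum; apply: eq_bigr => i _; apply: functionalZ. Qed.
End Functionals.

Section Hulls.
Local Open Scope classical_set_scope.
Local Open Scope ring_scope.
Variable R : realType.

Lemma conv_hull_fin (V : lmodType R) (A : set V) (I : finType)
    (a : I -> R) (v : I -> V) :
  (forall i, 0 <= a i) -> \sum_i a i = 1 -> (forall i, A (v i)) ->
  conv_hull A (\sum_i a i *: v i).
Proof.
move=> a0 a1 Av; exists #|I|, (a \o enum_val), (v \o enum_val).
have bij := onW_bij _ (@enum_val_bij I).
by split=> [i||i|] //=; [rewrite -a1 [RHS](reindex _ (bij _)) | rewrite [LHS](reindex _ (bij _))].
Qed.

Lemma aff_hull_fin (V : lmodType R) (A : set V) (I : finType)
    (a : I -> R) (v : I -> V) :
  \sum_i a i = 1 -> (forall i, A (v i)) -> aff_hull A (\sum_i a i *: v i).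
Proof.
move=> a1 Av; exists #|I|, (a \o enum_val), (v \o enum_val).
have bij := onW_bij _ (@enum_val_bij I).
by split=> [|i|] //=; [rewrite -a1 [RHS](reindex _ (bij _)) | rewrite [LHS](reindex _ (bij _))].
Qed.

Lemma sub_aff_hull (V : lmodType R) (A : set V) : A `<=` aff_hull A.
Proof.
move=> x Ax; have := @aff_hull_fin V A unit (fun=> 1) (fun=> x).
by rewrite !big_const card_unit /= !addr0 scale1r; apply.
Qed.

(** Two points of [A] are appended to the affine combination [y], with
the opposite weights [k] and [- k]. *)
Lemma aff_hull_translate (V : lmodType R) (A : set V) (y a b : V) (k : R) :
  aff_hull A y -> A a -> A b -> aff_hull A (y + k *: (a - b)).
Proof.
move=> [n [c [v [c1 Av ->]]]] Aa Ab.
pose c' (i : 'I_n + bool) := match i with inl j => c j | inr s => if s then k else - k end.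
pose v' (i : 'I_n + bool) := match i with inl j => v j | inr s => if s then a else b end.
have := @aff_hull_fin V A _ c' v'; rewrite !big_sumType !big_bool /= scaleNr scalerBr.
apply; first by rewrite subrr addr0.
by case=> [i|[]] //=.
Qed.

Lemma aff_hull_eq (V : vectType R) (A : set V) (l : 'Hom(V, R^o)) (c : R) :
  (forall x, A x -> l x = c) -> forall x, aff_hull A x -> l x = c.
Proof.
move=> lA x [n [a [v [a1 Av ->]]]]; rewrite linear_sum /=.
rewrite -[RHS]mul1r -a1 mulr_suml; apply: eq_bigr => i _.
by rewrite linearZ /= (lA _ (Av i)).
Qed.

(** The direction [U] is a subspace of maximal dimension among those whose
translate by [x] stays inside the affine hull; a point of [A] outside [x + U]
would allow to enlarge it. *)
Lemma aff_hull_coset (V : vectType R) (A : set V) (x : V) : A x ->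
  exists U : {vspace V}, aff_hull A = [set x + u | u in [set u | u \in U]].
Proof.
move=> Ax.
pose good (U : {vspace V}) := forall u, u \in U -> aff_hull A (x + u).
pose P d := `[< exists U, good U /\ \dim U = d >].
have P0 : exists d, P d.
  exists 0%N; apply/asboolP; exists 0%VS; split; last exact: dimv0.
  by move=> u; rewrite memv0 => /eqP ->; rewrite addr0; apply: sub_aff_hull.
have Pb d : P d -> (d <= \dim (fullv : {vspace V}))%N.
  by move=> /asboolP[U [_ <-]]; apply: dimvS (subvf _).
case: (ex_maxnP P0 Pb) => d /asboolP[U [gU dU]] dmax.
have AU a : A a -> a - x \in U.
  move=> Aa; apply: contraT => aU.
  have gU' : good (U + <[a - x]>)%VS.
    move=> u /memv_addP[u1 u1U [u2 /vlineP[k ->] ->]].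
    by rewrite addrA; apply: aff_hull_translate => //; apply: gU.
  have /dmax : P (\dim (U + <[a - x]>)) by apply/asboolP; exists (U + <[a - x]>)%VS.
  rewrite -dU => le; have := dimv_leqif_sup (addvSl U <[a - x]>).
  move=> [_]; rewrite eqn_leq le dimvS ?addvSl //= => /esym /subvP sub.
  by rewrite (sub (a - x)) // in aU; rewrite memvE addvSr.
exists U; apply/seteqP; split => [y [n [c [v [c1 Av ->]]]] | y [u /= uU <-]]; last exact: gU.
exists (\sum_i c i *: (v i - x)); first by apply: memv_suml => i _; apply/memvZ/AU.
under eq_bigr do rewrite scalerBr.
by rewrite sumrB -scaler_suml c1 scale1r addrC subrK.
Qed.

Lemma dimensionE (V : vectType R) (A : set V) (x : V) (U : {vspace V}) :
  aff_hull A = [set x + u | u in [set u | u \in U]] -> dimension A = \dim U.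
Proof.
move=> AU; apply: get_unique => [|d [y [W [AW <-]]]]; first by exists x, U.
have xy : x - y \in W.
  have : aff_hull A x by rewrite AU; exists 0; rewrite /= ?mem0v ?addr0.
  by rewrite AW => -[w /= wW <-]; rewrite addrC addKr.
suff -> : U = W by [].
apply/vspaceP => u; apply/idP/idP => uU.
  have : aff_hull A (x + u) by rewrite AU; exists u.
  rewrite AW => -[w /= wW e]; have -> : u = w - (x - y).
    by apply: (addrI x); rewrite -e opprB addrCA [x + _]addrC subrK addrC.
  exact: memvB.
have : aff_hull A (y + ((x - y) + u)) by rewrite AW; exists (x - y + u); rewrite //= memvD.
rewrite AU => -[w /= wU]; rewrite addrA [y + _]addrC subrK => /addrI <- //.
Qed.

Lemma aff_hull_dimension (V : vectType R) (A : set V) (x : V) : A x ->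
  exists2 U : {vspace V}, \dim U = dimension A &
    aff_hull A = [set x + u | u in [set u | u \in U]].
Proof. by move=> /aff_hull_coset[U AU]; exists U => //; rewrite (dimensionE AU). Qed.

Lemma dimension_set1 (V : vectType R) (x : V) : dimension [set x] = 0%N.
Proof.
rewrite -[RHS](dimv0 V); apply: (@dimensionE _ _ x).
apply/seteqP; split => [y [n [a [v [a1 Av ->]]]] | y [u /= /[!memv0]/eqP -> <-]].
  exists 0; first by rewrite /= mem0v.
  by rewrite addr0 (eq_bigr (fun i => a i *: x)) -?scaler_suml ?a1 ?scale1r // => i _;
    rewrite (Av i).
by rewrite addr0; apply: sub_aff_hull.
Qed.

Lemma dimension_eq0 (V : vectType R) (A : set V) (x : V) :
  A x -> dimension A = 0%N -> A = [set x].
Proof.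
move=> Ax A0; have [U] := aff_hull_dimension Ax.
rewrite A0 => /eqP; rewrite dimv_eq0 => /eqP -> AU.
apply/seteqP; split => [y Ay | y ->] //=.
have : aff_hull A y by apply: sub_aff_hull.
by rewrite AU => -[u /= /[!memv0]/eqP -> <-]; rewrite addr0.
Qed.

Lemma exists_hom (V W : vectType R) (f : V -> W) : linear f ->
  exists h : 'Hom(V, W), forall x, h x = f x.
Proof.
move=> lf; pose m := GRing.isLinear.Build _ _ _ _ f lf.
pose F : {linear V -> W} := HB.pack f m.
by exists (linfun F) => x; rewrite lfunE.
Qed.

End Hulls.

Section Hyperplanes.
Local Open Scope classical_set_scope.
Local Open Scope ring_scope.
Variables (R : realType) (V : vectType R).

Lemma lker_dim (l : 'Hom(V, R^o)) (v : V) : l v != 0 ->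
  \dim (fullv : {vspace V}) = (\dim (lker l)).+1.
Proof.
move=> lv; rewrite -(limg_ker_dim l fullv) capfv -[RHS]addn1; congr addn.
apply/eqP; rewrite eqn_leq; apply/andP; split.
  by have := dimvS (subvf (limg l)); rewrite !dimvf.
rewrite lt0n dimv_eq0; apply: contra lv => /eqP l0.
by have := memv_img l (memvf v); rewrite l0 memv0.
Qed.

Lemma hyperplane_coset (l : 'Hom(V, R^o)) (c : R) (x : V) : l x = c ->
  [set y | l y = c] = [set x + u | u in [set u | u \in lker l]].
Proof.
move=> lx; apply/seteqP; split => [y /= ly | y [u /= /[!memv_ker]/eqP lu <-]].
  exists (y - x); last by rewrite addrC subrK.
  by rewrite /= memv_ker linearB /= ly lx subrr.
by rewrite linearD /= lx lu addr0.
Qed.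

Definition linearly_spanning (A : set V) : Prop :=
  forall z, exists (n : nat) (a : 'I_n -> R) (v : 'I_n -> V),
    (forall i, A (v i)) /\ z = \sum_i a i *: v i.

Lemma spanning_fin (A : set V) (I : finType) (a : I -> R) (v : I -> V) :
  (forall i, A (v i)) -> exists (n : nat) (a' : 'I_n -> R) (v' : 'I_n -> V),
    (forall i, A (v' i)) /\ \sum_i a i *: v i = \sum_i a' i *: v' i.
Proof.
move=> Av; exists #|I|, (a \o enum_val), (v \o enum_val).
by split => [i|] //=; rewrite [LHS](reindex _ (onW_bij _ (@enum_val_bij I))).
Qed.

Lemma spanning_hom_eq (A : set V) (l l' : 'Hom(V, R^o)) :
  linearly_spanning A -> (forall x, A x -> l x = l' x) -> l = l'.
Proof.
move=> spanA ll'; apply/lfunP => z; have [n [a [v [Av ->]]]] := spanA z.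
by rewrite !linear_sum; apply: eq_bigr => i _; rewrite !linearZ /= ll'.
Qed.

(** Applying [l] to a linear combination of points where [l] is [1] returns the
sum of the coefficients, so that on [l = 1] linear combinations are affine. *)
Lemma aff_hull_spanning (A : set V) (l : 'Hom(V, R^o)) :
  linearly_spanning A -> (forall x, A x -> l x = 1) ->
  aff_hull A = [set y | l y = 1].
Proof.
move=> spanA lA; apply/seteqP; split => [y|y /= ly]; first exact: aff_hull_eq lA _.
have [n [a [v [Av yE]]]] := spanA y; exists n, a, v; split => //.
rewrite -ly yE linear_sum; apply: eq_bigr => i _.
by rewrite linearZ /= lA //; apply/esym/mulr1.
Qed.

Lemma f_card (k : nat) (Q : set V) (I : finType) (F : I -> set V) :
  injective F -> faces k Q = range F -> f_ k Q = #|I|.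
Proof.
move=> Finj FQ; rewrite /f_ FQ; apply: card_fset_set.
rewrite (card_eql (inj_card_eq (in2W Finj))) (card_eqr card_II).
rewrite -(card_eql (inj_card_eq (in2W (@enum_rank_inj I)))).
suff -> : range (@enum_rank I) = setT by [].
by apply/seteqP; split => // i _; exists (enum_val i); rewrite ?enum_valK.
Qed.
End Hyperplanes.

(** * Facets of an intersection of halfspaces *)

Section Facets.
Local Open Scope classical_set_scope.
Local Open Scope ring_scope.
Variables (R : realType) (V : vectType R) (B : finType).
Variables (l : B -> 'Hom(V, R^o)) (Q : set V).
Hypothesis Q_ineq : forall z, Q z <-> forall b, l b z <= 1.

(** A common admissible step [e] is the minimum over [b] of the steps that each
inequality allows on its own. *)
Lemma interior_direction (z v : V) : (forall b, l b z < 1) ->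
  exists2 e : R, 0 < e & Q (z + e *: v).
Proof.
move=> lz; pose d b := (1 - l b z) / (1 + `|l b v|).
have d0 b : 0 < d b by rewrite divr_gt0 ?subr_gt0 // ltr_pwDl.
exists (\big[Num.min/1]_b d b); first by apply/bigmin_gtP; split=> // b _; apply: d0.
set e := bigop _ _ _; apply/Q_ineq => b.
rewrite functionalD functionalZ -lerBrDl.
have eb : e <= d b by apply: bigmin_le_cond.
have e0 : 0 < e by apply/bigmin_gtP; split=> // b' _; apply: d0.
apply: (le_trans (ler_wpM2l (ltW e0) (ler_norm (l b v)))).
have [->|nz] := eqVneq (l b v) 0; first by rewrite normr0 mulr0 subr_ge0 ltW.
move: eb; rewrite ler_pdivlMr ?ltr_pwDl // mulrDr mulr1; apply: le_trans.
by rewrite lerDr ltW.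
Qed.

Lemma absorbing (v : V) : exists2 e : R, 0 < e & Q (e *: v).
Proof.
have [|e e0] := @interior_direction 0 v; first by move=> b; rewrite linear0.
by rewrite add0r; exists e.
Qed.

Lemma full_dimension : dimension Q = \dim (fullv : {vspace V}).
Proof.
apply: (@dimensionE _ _ _ 0); apply/seteqP; split => [y _ | y _].
  by exists y; rewrite /= ?memvf ?add0r.
have [e e0 Qy] := absorbing y.
have Q0 : Q 0 by apply/Q_ineq => b; rewrite linear0.
have := aff_hull_translate e^-1 (sub_aff_hull Q0) Qy Q0.
by rewrite subr0 add0r scalerA mulVf ?scale1r // gt_eqF.
Qed.

Hypothesis facet_span : forall b, linearly_spanning (Q `&` [set z | l b z = 1]).
Hypothesis l_inj : injective l.
Hypothesis V_pos : (0 < \dim (fullv : {vspace V}))%N.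

Lemma facet_nonempty b : exists2 x, Q x & l b x = 1.
Proof.
suff : exists v, v != 0 :> V.
  move=> [v]; have [[|n] [a [w [Aw ->]]]] := facet_span b v.
    by rewrite big_ord0 eqxx.
  by have [Qw lw] := Aw ord0; exists (w ord0).
exists (vpick (fullv : {vspace V})); rewrite vpick0 -dimv_eq0 -lt0n //.
Qed.

(** A face [F] of codimension one lies in some hyperplane [l b = 1]: otherwise
averaging points of [F] gives a point of [F] where no inequality is tight, an
interior point of [Q], and the functional defining [F] vanishes, so that [F] is
all of [Q].  By dimension, the hyperplane [l b = 1] is then the affine hull of
[F]. *)
Lemma facets_range :
  faces (\dim (fullv : {vspace V})).-1 Q =
  range (fun b => Q `&` [set z | l b z = 1]).
Proof.
apply/seteqP; split => [F [[m [c [mQ FE]]] [x0 Fx0] dF] | F [b _ <-]].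
  have [b lb1] : exists b, forall x, F x -> l b x = 1.
    apply: contrapT => /forallNP noF.
    have /choice[x xP] : forall b, exists x, F x /\ l b x < 1.
      move=> b; have /existsNP[x /not_implyP[Fx lx]] := noF b; exists x; split=> //.
      rewrite lt_neqAle; apply/andP; split; first exact/eqP.
      by move: Fx; rewrite FE => -[/Q_ineq/(_ b)].
    (* The average of [x0] and of these witnesses lies in [F] and in the
       interior of [Q], so [m] has a maximum at an interior point. *)
    pose y i := if i is Some b then x b else x0.
    pose N : R := #|{: option B}|%:R.
    have N0 : 0 < N by rewrite ltr0n card_option.
    pose z := \sum_i N^-1 *: y i.
    have Fy i : F (y i) by case: i => [b|] //=; case: (xP b).
    have my i : m (y i) = c by have := Fy i; rewrite FE => -[].
    have sumc (e : R) : \sum_(i : option B) e = N * e.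
      by rewrite sumr_const mulr_natl.
    have mz : m z = c.
      rewrite functional_sum (eq_bigr (fun=> N^-1 * c)) => [|i _]; last by rewrite my.
      by rewrite sumc mulVKf // gt_eqF.
    have lz b : l b z < 1.
      rewrite functional_sum -mulr_sumr.
      rewrite mulrC ltr_pdivrMr // mul1r -[N]mulr1 -sumc.
      rewrite (bigD1 (Some b)) //= [ltRHS](bigD1 (Some b)) //=.
      apply: ltr_leD; first by case: (xP b).
      by apply: ler_sum => i _; have := Fy i; rewrite FE => -[/Q_ineq].
    have m_le0 v : m v <= 0.
      have [e e0 /mQ] := interior_direction v lz.
      by rewrite functionalD functionalZ mz gerDl pmulr_rle0.
    have m0 v : m v = 0.
      apply/eqP; rewrite eq_le m_le0 /=.
      by have := m_le0 (- v); rewrite -scaleN1r functionalZ mulN1r oppr_le0.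
    have FQ : F = Q.
      by rewrite FE; apply/seteqP; split => [v []//|v Qv]; split; rewrite //= -mz !m0.
    by move: dF V_pos; rewrite FQ full_dimension; case: (\dim _) => //= n /esym/n_Sn.
  exists b => //.
  have [U dU AU] := aff_hull_dimension Fx0.
  have lbAU x : aff_hull F x -> l b x = 1 by apply: aff_hull_eq.
  have mAU x : aff_hull F x -> m x = c.
    by apply: aff_hull_eq => y; rewrite FE => -[].
  have lx0 : l b x0 = 1 by apply: lb1.
  have UE : U = lker (l b).
    apply/eqP; rewrite eqEdim; apply/andP; split.
      apply/subvP => u uU; have : aff_hull F (x0 + u) by rewrite AU; exists u.
      by move=> /lbAU; rewrite functionalD lx0 memv_ker => /(canRL (addKr _)) ->; rewrite addNr.
    by rewrite dU dF (@lker_dim _ _ (l b) x0) ?lx0 ?oner_neq0.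
  apply/seteqP; split => [x [Qx lx] | x Fx]; last first.
    by split; [move: Fx; rewrite FE => -[] | apply: lb1].
  rewrite FE; split => //=; apply: mAU.
  by rewrite AU UE -(hyperplane_coset lx0).
have [x0 Qx0 lx0] := facet_nonempty b.
split.
- exists (l b), 1; split => // z /Q_ineq; exact.
- by exists x0.
- have := aff_hull_spanning (@facet_span b) (fun x Fx => proj2 Fx).
  rewrite (hyperplane_coset lx0) => /dimensionE ->.
  by rewrite (@lker_dim _ _ (l b) x0) ?lx0 ?oner_neq0.
Qed.

Lemma facets_card : f_ (\dim (fullv : {vspace V})).-1 Q = #|B|.
Proof.
apply: f_card facets_range => b b' bb'; apply: l_inj.
apply: (spanning_hom_eq (@facet_span b)) => x Fx.
have [_ lx] := Fx; rewrite /= in lx; rewrite lx.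
by move: Fx; rewrite bb' => -[_ ->].
Qed.
End Facets.

(** * Vertices of a convex hull *)

Section Vertices.
Local Open Scope classical_set_scope.
Local Open Scope ring_scope.
Variables (R : realType) (V : vectType R) (A : finType).
Variables (w : A -> V) (Q : set V).
Hypothesis Q_hull : forall z, Q z <-> exists p : A -> R,
  [/\ forall i, 0 <= p i, \sum_i p i = 1 & z = \sum_i p i *: w i].
Hypothesis w_exposed : forall a, is_face Q [set w a].
Hypothesis w_inj : injective w.

Lemma hull_generator a : Q (w a).
Proof.
apply/Q_hull; exists (fun i => (i == a)%:R); split.
- by move=> i; apply: ler0n.
- by rewrite (bigD1 a) //= eqxx big1 ?addr0 // => i /negbTE ->.
- by rewrite (bigD1 a) //= eqxx scale1r big1 ?addr0 // => i /negbTE ->; rewrite scale0r.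
Qed.

Lemma hull_functional_le (l : 'Hom(V, R^o)) (c : R) :
  (forall a, l (w a) <= c) -> forall z, Q z -> l z <= c.
Proof.
move=> lw z /Q_hull[p [p0 p1 ->]]; rewrite functional_sum -[leRHS]mul1r -p1 mulr_suml.
by apply: ler_sum => i _; apply: ler_wpM2l.
Qed.

(** A functional that attains its maximum at a convex combination attains it at
some generator, so that a face reduced to a point is a generator. *)
Lemma vertices_range : faces 0 Q = range (fun a => [set w a]).
Proof.
apply/seteqP; split => [F [[l [c [lQ FE]]] [x Fx] dF] | F [a _ <-]]; last first.
  by split; [apply: w_exposed | exists (w a) | rewrite dimension_set1].
have Fx1 := dimension_eq0 Fx dF.
have [/Q_hull[p [p0 p1 xE]] lx] : Q x /\ l x = c by move: Fx; rewrite FE.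
have [a pa] : exists a, p a != 0.
  apply: contrapT => /forallNP np; have /eqP := p1.
  rewrite big1 => [|i _]; first by rewrite eq_sym oner_eq0.
  by apply/eqP; apply: contraT => /np.
have /eqP : \sum_i p i * (c - l (w i)) = 0.
  under eq_bigr do rewrite mulrBr.
  by rewrite sumrB -mulr_suml p1 mul1r -functional_sum -xE lx subrr.
rewrite psumr_eq0 => [/allP/(_ a (mem_index_enum _))|i _]; last first.
  by rewrite mulr_ge0 // subr_ge0 lQ //; apply: hull_generator.
rewrite /= mulf_eq0 (negbTE pa) subr_eq0 /= => /eqP lwa.
exists a => //; suff : F (w a) by rewrite Fx1 => ->.
by rewrite FE; split; [apply: hull_generator|].
Qed.

Lemma vertices_card : f_ 0 Q = #|A|.
Proof.
apply: f_card vertices_range => a a' aa'; apply: w_inj.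
by have : [set w a] (w a) by []; rewrite aa'.
Qed.
End Vertices.

(** * Two-level centrally symmetric polytopes *)

Definition signed (R : realType) (V : lmodType R) (A : finType) (w : A -> V)
  (i : bool * A) : V := ((-1) ^+ i.1 *: w i.2)%R.

Section TwoLevel.
Local Open Scope classical_set_scope.
Local Open Scope ring_scope.
Variables (R : realType) (V : vectType R) (A B : finType).
Variables (w : A -> V) (l : B -> 'Hom(V, R^o)) (Q : set V).
Hypothesis Q_hull : forall z, Q z <-> exists p : bool * A -> R,
  [/\ forall i, 0 <= p i, \sum_i p i = 1 & z = \sum_i p i *: signed w i].
Hypothesis Q_ineq : forall z, Q z <-> forall b, `|l b z| <= 1.
Hypothesis two_level : forall a b, exists s : bool, l b (w a) = (-1) ^+ s.
Hypothesis l_sep : forall z, (forall b, l b z = 0) -> z = 0.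
Hypothesis w_inj : injective (signed w).
Hypothesis l_inj : injective (signed l).
Hypothesis V_pos : (0 < \dim (fullv : {vspace V}))%N.

Lemma signed_functional (i : bool * B) (z : V) :
  signed l i z = (-1) ^+ i.1 * l i.2 z :> R.
Proof. by rewrite /signed scale_lfunE. Qed.

Lemma signedM (s : bool) (i : bool * A) :
  (-1) ^+ s *: signed w i = signed w (s (+) i.1, i.2).
Proof. by rewrite /signed scalerA signr_addb. Qed.

Lemma signed_two_level (i : bool * A) (j : bool * B) :
  exists s : bool, signed l j (signed w i) = (-1) ^+ s :> R.
Proof.
have [s ls] := two_level i.2 j.2; exists (j.1 (+) (i.1 (+) s)).
by rewrite signed_functional functionalZ ls !signr_addb.
Qed.

Lemma signed_ineq (z : V) : Q z <-> forall i, signed l i z <= 1.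
Proof.
rewrite Q_ineq; split => [lz [s b]|lz b].
  rewrite signed_functional; apply: le_trans (lz b).
  by rewrite (le_trans (ler_norm _)) // normrM normrX normrN1 expr1n mul1r.
have := lz (false, b); have := lz (true, b); rewrite !signed_functional /=.
by rewrite expr1 expr0 mulN1r mul1r ler_norml lerNl => -> ->.
Qed.

(** The inequalities make [Q] a neighbourhood of the origin, and [Q] consists of
combinations of generators. *)
Lemma spanning_generators (z : V) : exists c : bool * A -> R,
  z = \sum_i c i *: signed w i.
Proof.
have [e e0 /Q_hull[p [_ _ zE]]] := absorbing signed_ineq z.
exists (fun i => e^-1 * p i); under eq_bigr do rewrite -scalerA.
by rewrite -scaler_sumr -zE scalerA mulVf ?scale1r // gt_eqF.
Qed.

(** Each generator or its opposite lies on the facet, and the generators span. *)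
Lemma two_level_facet_span (j : bool * B) :
  linearly_spanning (Q `&` [set z | signed l j z = 1]).
Proof.
move=> z; have [c ->] := spanning_generators z.
have /choice[s sP] := fun i => signed_two_level i j.
rewrite (_ : \sum_i _ = \sum_i (c i * (-1) ^+ s i) *: ((-1) ^+ s i *: signed w i)); last first.
  by apply: eq_bigr => i _; rewrite [RHS]scalerA -mulrA -signr_addb addbb mulr1.
apply: spanning_fin => i; split => /=.
  by rewrite signedM; apply: hull_generator Q_hull _.
by rewrite functionalZ sP -signr_addb addbb.
Qed.

(** The sum of all the functionals equal to [1] at the generator is maximal
where each of them is [1]; as one of [l b] and [- l b] occurs in the sum for
every [b], this determines the point. *)
Lemma two_level_exposed (i : bool * A) : is_face Q [set signed w i].
Proof.
pose S := [pred j | signed l j (signed w i) == 1].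
pose m := \sum_(j | S j) signed l j.
have mE z : m z = \sum_(j | S j) signed l j z :> R by rewrite sum_lfunE.
exists m, (\sum_(j | S j) 1); split => [z /signed_ineq Qz|].
  by rewrite mE; apply: ler_sum => j _; apply: Qz.
have Qi : Q (signed w i) by apply: hull_generator Q_hull _.
apply/seteqP; split => [_ ->|z [Qz /= mz]] /=.
  by split => //=; rewrite mE; apply: eq_bigr => j /eqP.
have Sz j : S j -> signed l j z = 1 :> R.
  move=> Sj; have /eqP : \sum_(j | S j) (1 - signed l j z) = 0.
    by rewrite sumrB -mE mz subrr.
  rewrite psumr_eq0 => [/allP/(_ j (mem_index_enum _))|j' _]; last first.
    by rewrite subr_ge0; have /signed_ineq := Qz.
  by rewrite Sj /= subr_eq0 => /eqP <-.
apply/eqP; rewrite -subr_eq0; apply/eqP/l_sep => b.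
have [s sP] := signed_two_level i (false, b).
have lw : l b (signed w i) = (-1) ^+ s :> R.
  by rewrite -sP signed_functional expr0 mul1r.
have : signed l (s, b) z = 1 :> R.
  by apply: Sz; rewrite /= signed_functional /= lw -signr_addb addbb.
rewrite signed_functional /= => /(congr1 ( *%R ((-1) ^+ s))).
rewrite mulrA -signr_addb addbb expr0 mul1r mulr1 => lz.
by rewrite -[- _]scaleN1r functionalD functionalZ lw lz mulN1r subrr.
Qed.

Lemma two_level_facets : f_ (\dim (fullv : {vspace V})).-1 Q = (2 * #|B|)%N.
Proof.
rewrite (facets_card signed_ineq two_level_facet_span l_inj V_pos).
by rewrite card_prod card_bool.
Qed.

Lemma two_level_vertices : f_ 0 Q = (2 * #|A|)%N.
Proof.
rewrite (vertices_card Q_hull two_level_exposed w_inj).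
by rewrite card_prod card_bool.
Qed.

Lemma two_level_dimension : dimension Q = \dim (fullv : {vspace V}).
Proof. exact: full_dimension signed_ineq. Qed.

(** With as many functionals as dimensions, [z |-> (l b z)_b] is bijective. *)
Lemma two_level_cube (D : nat) : \dim (fullv : {vspace V}) = D -> #|B| = D ->
  aff_isomorphic Q (cube R D).
Proof.
move=> dV dB.
pose f z : 'rV[R]_D := \row_i l (enum_val (cast_ord (esym dB) i)) z.
have [h hE] : exists h : 'Hom(V, 'rV[R]_D), forall z, h z = f z.
  apply: exists_hom => k x y; apply/rowP => i.
  by rewrite !mxE functionalD functionalZ.
have hb z b : h z 0 (cast_ord dB (enum_rank b)) = l b z.
  by rewrite hE mxE cast_ordK enum_rankK.
have hinj : lker h == 0%VS.
  apply/eqP/vspaceP => z; rewrite memv_ker memv0; apply/eqP/eqP => [hz|->].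
    by apply: l_sep => b; rewrite -hb hz mxE.
  by rewrite linear0.
have hsurj y : exists z, y = h z.
  have /eqP : limg h == fullv.
    by rewrite eqEdim subvf limg_dim_eq ?(eqP hinj) ?capv0 // dV dimvf /dim /= mul1n.
  by move=> lh; have := memvf y; rewrite -lh => /memv_imgP[z _ ->]; exists z.
exists h, 0; split => [z Qz i|z z' _ _|y y1] /=.
- rewrite addr0 hE mxE -ler_norml; exact: (Q_ineq z).1.
- by rewrite !addr0; apply/lker0P.
- have [z zE] := hsurj y; exists z; last by rewrite addr0.
  by apply/Q_ineq => b; rewrite ler_norml -hb -zE; apply: y1.
Qed.

(** With as many generators as dimensions, the [w a] form a basis, and the
vectors [(l b (w a))_a], which lie in the cube, bound each [l b] on the points
whose coordinates are in the polar of the cube. *)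
Lemma two_level_cross (D : nat) : \dim (fullv : {vspace V}) = D -> #|A| = D ->
  aff_isomorphic Q (cross_polytope R D).
Proof.
move=> dV dA.
pose o (i : 'I_D) := enum_val (cast_ord (esym dA) i).
pose f (y : 'rV[R]_D) := \sum_i y 0 i *: w (o i).
have [g gE] : exists g : 'Hom('rV[R]_D, V), forall y, g y = f y.
  apply: exists_hom => k x y; rewrite /f scaler_sumr -big_split /=.
  by apply: eq_bigr => i _; rewrite !mxE scalerDl scalerA.
pose r a := cast_ord dA (enum_rank a).
have or a : o (r a) = a by rewrite /o /r cast_ordK enum_rankK.
have gw a : g (delta_mx 0 (r a)) = w a.
  rewrite gE /f (bigD1 (r a)) //= mxE !eqxx scale1r or big1 ?addr0 // => i.
  by rewrite mxE eqxx => /negbTE ->; rewrite scale0r.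
have gsurj z : exists y, g y = z.
  have [c ->] := spanning_generators z.
  exists (\sum_i (c i * (-1) ^+ i.1) *: delta_mx 0 (r i.2)).
  by rewrite linear_sum; apply: eq_bigr => i _; rewrite linearZ /= gw /signed scalerA.
have ginj : lker g == 0%VS.
  have lg : limg g = fullv.
    by apply/vspaceP => z; have [y <-] := gsurj z; rewrite memv_img ?memvf.
  have := limg_ker_dim g fullv; rewrite capfv lg dV [RHS]dimvf /dim /= mul1n.
  by move=> /eqP; rewrite -[X in _ == X]add0n eqn_add2r dimv_eq0.
have gK := lker0_lfunK ginj.
have Kg z : g ((g^-1)%VF z) = z by have [y <-] := gsurj z; rewrite gK.
have crossP z : Q z <-> cross_polytope R D ((g^-1)%VF z).
  split => [Qz x x1|cz].
    (* It is enough to bound the pairing with [x] at the generators, where its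
       values are the entries of [x] up to sign. *)
    have [m mE] : exists m : 'Hom(V, R^o), forall z, m z = \sum_i x 0 i * (g^-1)%VF z 0 i.
      apply: exists_hom => k z1 z2; rewrite /= scaler_sumr -big_split /=.
      by apply: eq_bigr => i _; rewrite linearP !mxE mulrDr mulrCA.
    rewrite -mE; apply: (hull_functional_le Q_hull) Qz => -[s a].
    rewrite functionalZ mE -gw gK (bigD1 (r a)) //= mxE !eqxx mulr1 big1 => [|i ir]; last first.
      by rewrite mxE eqxx (negbTE ir) mulr0.
    rewrite addr0 (le_trans (ler_norm _)) // normrM normrX normrN1 expr1n mul1r.
    by rewrite ler_norml; apply: x1.
  apply/signed_ineq => j.
  have := cz (\row_i signed l j (w (o i))); rewrite -{2}(Kg z) gE /f functional_sum.
  under eq_bigr do rewrite mxE mulrC; apply => i.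
  rewrite mxE -ler_norml signed_functional; have [s ->] := two_level (o i) j.2.
  by rewrite -signr_addb normrX normrN1 expr1n.
exists (g^-1)%VF, 0; split => [z|z z' _ _|y cy] /=.
- by rewrite addr0 => /crossP.
- by rewrite !addr0 => /(congr1 g); rewrite !Kg.
- exists (g y); last by rewrite addr0 gK.
  by apply/crossP; rewrite gK.
Qed.
End TwoLevel.

(** * Affine invariance of face numbers *)

Section AffineInvarianceOfFaces.
Local Open Scope classical_set_scope.
Local Open Scope ring_scope.

Lemma card_fset_set_image (T U : choiceType) (f : T -> U) (A : set T) :
  injective f -> #|` fset_set (f @` A)| = #|` fset_set A|.
Proof.
move=> finj; have AfA : (f @` A #= A)%card by apply: inj_card_eq; apply: in2W.
have fin := eq_finite_set AfA.
have [Afin|Ainf] := pselect (finite_set A).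
  by rewrite fset_set_image // card_imfset.
have fAinf : ~ finite_set (f @` A) by rewrite fin.
by rewrite /fset_set; case: pselect => // _; case: pselect.
Qed.

Section AffineInvariance.
Variables (R : realType) (V W : vectType R) (h : 'Hom(V, W)) (b : W).
Variable (g : 'Hom(W, V)).
Hypotheses (hK : cancel h g) (gK : cancel g h).

Let f x := h x + b.
Let f_inj : injective f.
Proof. by move=> x y /addIr/(can_inj hK). Qed.

Lemma aff_hull_affine (A : set V) : aff_hull (f @` A) = f @` aff_hull A.
Proof.
have fsum n (a : 'I_n -> R) (v : 'I_n -> V) : \sum_i a i = 1 ->
    \sum_i a i *: f (v i) = f (\sum_i a i *: v i).
  move=> a1; under eq_bigr do rewrite scalerDr.
  rewrite big_split /= -scaler_suml a1 scale1r /f linear_sum /=.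
  by under [in RHS]eq_bigr do rewrite linearZ.
apply/seteqP; split => [_ [n [a [v [a1 Av ->]]]] | _ [x [n [a [v [a1 Av ->]]]] <-]].
  have /choice[u uP] : forall i, exists x, A x /\ f x = v i.
    by move=> i; have [x] := Av i; exists x.
  exists (\sum_i a i *: u i).
    by exists n, a, u; split => // i; have [] := uP i.
  by rewrite -fsum //; apply: eq_bigr => i _; have [_ ->] := uP i.
exists n, a, (f \o v); rewrite fsum //; split=> // i; by exists (v i).
Qed.

Lemma dimension_affine (A : set V) : A !=set0 -> dimension (f @` A) = dimension A.
Proof.
move=> [x Ax]; have [U <- AU] := aff_hull_dimension Ax.
have hinj : lker h == 0%VS by apply/lker0P; apply: can_inj hK.
rewrite -(@limg_dim_eq _ _ _ h U) ?(eqP hinj) ?capv0 //.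
apply: (@dimensionE _ _ _ (f x)); rewrite aff_hull_affine AU.
apply/seteqP; split => [_ [_ [u uU <-] <-] | _ [_ /memv_imgP[u uU ->] <-]].
  by exists (h u); rewrite /= ?memv_img // /f linearD addrAC.
by exists (x + u); [exists u | rewrite /f linearD addrAC].
Qed.

Lemma is_face_affine (Q F : set V) : is_face Q F <-> is_face (f @` Q) (f @` F).
Proof.
split => [[l [c [lQ FE]]]|[l [c [lQ FE]]]].
  exists (l \o g)%VF, (c + l (g b)); split => [_ [x Qx <-]|].
    by rewrite comp_lfunE /f linearD /= hK functionalD lerD2r lQ.
  rewrite FE; apply/seteqP; split => [_ [x [Qx /= lx] <-]|_ [[x Qx <-]]].
    by split; [exists x | rewrite /= comp_lfunE /f linearD /= hK functionalD lx].
  rewrite /= comp_lfunE /f linearD /= hK functionalD => /addIr lx.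
  by exists x.
exists (l \o h)%VF, (c - l b); split => [x Qx|].
  by rewrite comp_lfunE lerBrDr -functionalD; apply: lQ; exists x.
apply/seteqP; split => [x Fx | x [Qx /= lx]].
  have : (f @` F) (f x) by exists x.
  rewrite FE => -[[y Qy /f_inj <-]] /= ly; split => //=.
  by rewrite comp_lfunE -ly functionalD addrK.
have : (f @` F) (f x).
  rewrite FE; split; first by exists x.
  by rewrite /= functionalD; move: lx; rewrite comp_lfunE => ->; rewrite subrK.
by move=> [y Fy /f_inj <-].
Qed.

Lemma f_affine (k : nat) (Q : set V) : f_ k (f @` Q) = f_ k Q.
Proof.
rewrite /f_ -(@card_fset_set_image _ _ (fun F : set V => f @` F)); last first.
  move=> F G FG; apply/seteqP; split => x Fx.
    have : (f @` G) (f x) by rewrite -FG; exists x.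
    by move=> [y Gy /f_inj <-].
  have : (f @` F) (f x) by rewrite FG; exists x.
  by move=> [y Fy /f_inj <-].
congr (#|` fset_set _|); apply/seteqP; split.
  move=> F [Fface F0 Fk].
  have FE : F = f @` (f @^-1` F).
    apply/seteqP; split => [y Fy|_ [x Fx <-] //].
    by exists (g (y - b)); rewrite /= /f gK subrK.
  have F0' : f @^-1` F !=set0.
    by have [y] := F0; rewrite {1}FE => -[x Fx _]; exists x.
  exists (f @^-1` F); last by rewrite -FE.
  by split => //; [apply/is_face_affine; rewrite -FE | rewrite -dimension_affine // -FE].
move=> _ [F [Fface F0 Fk] <-]; split; first exact/is_face_affine.
- by have [x Fx] := F0; exists (f x); exists x.
- by rewrite dimension_affine.
Qed.
End AffineInvariance.

(** An affine map that is injective on a set with interior point 0 has an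
injective linear part: a kernel vector can be scaled into the set. *)
Lemma f_aff_isomorphic (R : realType) (V W : vectType R) (Q : set V) (Q' : set W)
    (k : nat) :
  (forall v, exists2 e : R, 0 < e & Q (e *: v)) ->
  \dim (fullv : {vspace V}) = \dim (fullv : {vspace W}) ->
  aff_isomorphic Q Q' -> f_ k Q' = f_ k Q.
Proof.
move=> absQ dVW [h [b [fQ finj fsurj]]].
have Q0 : Q 0 by have [e _] := absQ 0; rewrite scaler0.
have hker : lker h == 0%VS.
  apply/eqP/vspaceP => z; rewrite memv_ker memv0; apply/eqP/eqP => [hz|->]; last by rewrite linear0.
  have [e e0 Qz] := absQ z.
  have := finj _ _ (mem_set Qz) (mem_set Q0).
  rewrite linearZ /= hz scaler0 linear0 => /(_ erefl)/eqP.
  by rewrite scaler_eq0 gt_eqF //= => /eqP.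
have hK := lker0_lfunK hker.
have gK : cancel (h^-1)%VF h.
  move=> y; apply: limg_lfunVK.
  have /eqP -> : limg h == fullv; last by rewrite memvf.
  by rewrite eqEdim subvf limg_dim_eq ?(eqP hker) ?capv0 ?dVW /= ?leqnn.
have -> : Q' = (fun x => h x + b) @` Q.
  by apply/seteqP; split => [y /fsurj [x Qx <-]|_ [x Qx <-]]; [exists x | apply: fQ].
exact: f_affine hK gK k Q.
Qed.
End AffineInvarianceOfFaces.

(** * Alternating sums along chains *)

Section ChainsAndDownSets.
Variables (T : finType) (le : rel T).

Definition comparable_rel : rel T := fun x y => le x y || le y x.

Definition down_closed (I : {set T}) : bool :=
  [forall x, forall y, (le x y && (y \in I)) ==> (x \in I)].

Definition chain_type : finType := {C : {set T} | homogeneous comparable_rel C}.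
Definition down_set_type : finType := {I : {set T} | down_closed I}.

Lemma comparable_rel_sym : symmetric comparable_rel.
Proof. by move=> x y; rewrite /comparable_rel orbC. Qed.

Lemma down_closedP (I : {set T}) :
  reflect (forall x y, le x y -> y \in I -> x \in I) (down_closed I).
Proof.
apply: (iffP forallP) => [h x y xy yI|h x].
  by have /forallP/(_ y) := h x; rewrite xy yI.
by apply/forallP => y; apply/implyP => /andP[]; apply: h.
Qed.

Hypotheses (leT_refl : reflexive le) (leT_anti : antisymmetric le).
Hypothesis leT_trans : transitive le.

Lemma chain_min (C : {set T}) : homogeneous comparable_rel C -> C != finset.set0 ->
  exists2 p, p \in C & forall c, c \in C -> le p c.
Proof.
move=> /homogeneousP chC /set0Pn[c0 c0C].
have [p pC pmin] := arg_minnP (fun p => #|[set d in C | le d p]|) c0C.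
have {}pC : p \in C := pC.
exists p => // c cC; have [<-|pc] := eqVneq p c; first exact: leT_refl.
have /orP[//|cp] := chC _ _ pC cC pc.
have := pmin c cC; rewrite leqNgt => /negP[]; apply/proper_card/properP; split.
  by apply/fintype.subsetP => d; rewrite !inE => /andP[-> dc]; rewrite (leT_trans dc).
exists p; rewrite !inE pC ?leT_refl //=; apply: contra pc => pc.
by apply/eqP/leT_anti; rewrite pc.
Qed.
Lemma homogeneous_sub (r : rel T) (C C' : {set T}) : C' \subset C ->
  homogeneous r C -> homogeneous r C'.
Proof.
move=> /fintype.subsetP sub /homogeneousP h.
by apply/homogeneousP => x y /sub xC /sub yC; apply: h.
Qed.

Section AlternatingSum.
Local Open Scope ring_scope.
Variable R : realType.

(** Counting predecessors gives the sign of [c] without enumerating the chain. *)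
Definition chain_rank (C : {set T}) (c : T) : nat := #|[set d in C | (d != c) && le d c]|.

Definition alternating_sum (C : {set T}) (x : T -> R) : R :=
  \sum_(c in C) (-1) ^+ chain_rank C c * x c.

Lemma alternating_sum0 (x : T -> R) : alternating_sum finset.set0 x = 0.
Proof. by rewrite /alternating_sum big_set0. Qed.

Lemma alternating_sumN (C : {set T}) (x : T -> R) :
  alternating_sum C (fun p => - x p) = - alternating_sum C x.
Proof. by rewrite /alternating_sum -sumrN; apply: eq_bigr => c _; rewrite mulrN. Qed.

(** A new least element has rank zero and increases every other rank by one. *)
Lemma alternating_sum_cons (C : {set T}) (p : T) (x : T -> R) : p \notin C ->
  (forall c, c \in C -> le p c) ->
  alternating_sum (p |: C) x = x p - alternating_sum C x.
Proof.
move=> pC pmin; rewrite /alternating_sum big_setU1 //=; congr (_ + _).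
  suff -> : chain_rank (p |: C) p = 0%N by rewrite expr0 mul1r.
  apply: eq_card0 => d; rewrite !inE; case: eqP => //= dp.
  apply/negP => /andP[dC dlep]; apply: dp; apply: leT_anti.
  by rewrite dlep pmin.
rewrite -sumrN; apply: eq_bigr => c cC; rewrite -mulNr; congr (_ * _).
suff -> : chain_rank (p |: C) c = (chain_rank C c).+1 by rewrite exprS mulN1r.
have pc : p != c by apply: contra pC => /eqP ->.
rewrite /chain_rank (cardsD1 p) !inE eqxx pc pmin //= add1n; congr S.
apply: eq_card => d; rewrite !inE.
by have [->|//] := eqVneq d p; rewrite (negbTE pC).
Qed.

(** A down-set meets a chain in an initial segment, on which the alternating
signs cancel up to at most the first one. *)
Lemma alternating_sum_indicator (C I : {set T}) :
  homogeneous comparable_rel C -> down_closed I ->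
  exists s : bool, alternating_sum C (fun p => (p \in I)%:R) = s%:R.
Proof.
move=> + /down_closedP dI.
elim: {C}#|C| {-2}C (erefl #|C|) => [C /eqP|n IH C Cn chC].
  by rewrite cards_eq0 => /eqP -> _; exists false; rewrite alternating_sum0.
have [|p pC pmin] := chain_min chC; first by rewrite -cards_eq0 Cn.
have [pI|pI] := boolP (p \in I); last first.
  exists false; rewrite /alternating_sum big1 // => c cC.
  suff /negbTE -> : c \notin I by rewrite mulr0.
  by apply: contra pI; apply/dI/pmin.
have [||s sE] := IH (C :\ p).
- by have := cardsD1 p C; rewrite pC Cn => -[].
- by apply: homogeneous_sub chC; apply: finset.subD1set.
exists (~~ s); rewrite -(finset.setD1K pC) alternating_sum_cons.
- by rewrite sE pI; case: s {sE}; rewrite ?subrr ?subr0.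
- by rewrite !inE eqxx.
- by move=> c; rewrite !inE => /andP[_ /pmin].
Qed.

(** The positive part of a Jordan decomposition of [x]: the least nonnegative
order-reversing [u] for which [u - x] is nonnegative and order reversing. *)
Definition upper_variation (x : T -> R) (p : T) : R :=
  \big[Num.max/0]_(C : {set T} | homogeneous comparable_rel C &&
     [forall c in C, le p c]) alternating_sum C x.

Lemma upper_variation_ge0 x p : 0 <= upper_variation x p.
Proof. exact: bigmax_ge_id. Qed.

Lemma upper_variation_ge x p (C : {set T}) : homogeneous comparable_rel C ->
  (forall c, c \in C -> le p c) -> alternating_sum C x <= upper_variation x p.
Proof.
move=> chC pC; apply: le_bigmax_cond; rewrite chC /=.
by apply/forallP => c; apply/implyP; apply: pC.
Qed.

Lemma upper_variation_le x p (M : R) :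
  (forall C : {set T}, homogeneous comparable_rel C ->
    (forall c, c \in C -> le p c) -> alternating_sum C x <= M) ->
  upper_variation x p <= M.
Proof.
move=> h; apply/bigmax_leP; split => [|C /andP[chC /forallP pC]].
  rewrite -(alternating_sum0 x); apply: h => [|c]; last by rewrite inE.
  by apply/homogeneousP => a b; rewrite inE.
by apply: h => // c cC; have /implyP := pC c; apply.
Qed.

Lemma upper_variation_decr x p q : le p q -> upper_variation x q <= upper_variation x p.
Proof.
move=> pq; apply: upper_variation_le => C chC qC; apply: upper_variation_ge => // c cC.
exact: leT_trans (qC _ cC).
Qed.

(** Adding [p] to a chain above [p], or removing it, turns an alternating sum
[s] into [x p - s]. *)
Lemma upper_variation_sub_le x p :
  upper_variation x p <= x p + upper_variation (fun q => - x q) p.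
Proof.
apply: upper_variation_le => C chC pmin.
have [pC|pC] := boolP (p \in C).
  rewrite -(finset.setD1K pC) alternating_sum_cons ?inE ?eqxx //; last first.
    by move=> c; rewrite !inE => /andP[_ /pmin].
  rewrite lerD2l -alternating_sumN; apply: upper_variation_ge.
    by apply: homogeneous_sub chC; apply: finset.subD1set.
  by move=> c; rewrite !inE => /andP[_ /pmin].
rewrite -lerBlDl -opprB -alternating_sum_cons // -alternating_sumN.
apply: upper_variation_ge => [|c]; last first.
  by rewrite !inE => /orP[/eqP ->|/pmin //]; apply: leT_refl.
apply/homogeneousP => a b; rewrite !inE /comparable_rel.
move=> /orP[/eqP ->|aC] /orP[/eqP ->|bC]; rewrite ?eqxx //.
- by rewrite pmin.
- by rewrite pmin ?orbT.
- by move: a b aC bC; apply/homogeneousP.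
Qed.

Lemma upper_variation_sub x p :
  x p = upper_variation x p - upper_variation (fun q => - x q) p.
Proof.
apply/eqP; rewrite eq_sym subr_eq; apply/eqP/le_anti.
rewrite upper_variation_sub_le /= addrC -lerBrDr addrC.
have := upper_variation_sub_le (fun q => - x q) p.
have -> : (fun q => - - x q) = x by apply/funext => q; rewrite opprK.
by [].
Qed.
End AlternatingSum.
End ChainsAndDownSets.

(** * The double order polytope of a poset with itself *)

Section DoubleOrderPolytope.
Local Open Scope ring_scope.
Variables (R : realType) (T : finType) (le : rel T).
Hypotheses (leT_refl : reflexive le) (leT_anti : antisymmetric le).
Hypothesis leT_trans : transitive le.

Local Notation E := ({ffun T -> R^o} * R^o)%type.
Local Notation chain := (chain_type le).
Local Notation down_set := (down_set_type le).
Local Notation Q := (double_order_polytope R T le le).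

Lemma down_set0_closed : down_closed le finset.set0.
Proof. by apply/down_closedP => x y; rewrite !inE. Qed.

(** Subtract from [x] its least positive value on its support, which is a
down-set, and repeat; what is left of [M] at the end is put on the empty set. *)
Lemma layer_cake (x : T -> R) (M : R) : (forall p, 0 <= x p <= M) -> 0 <= M ->
  (forall p q, le p q -> x q <= x p) ->
  exists a : down_set -> R, [/\ forall I, 0 <= a I, \sum_I a I = M &
    forall p, x p = \sum_I a I * (p \in val I)%:R].
Proof.
elim: {x}_.+1 {-2}x M (ltnSn #|[set p | 0 < x p]|) => // n IH x M xn xM M0 decr.
pose S := [set p | 0 < x p].
have x0 p : p \notin S -> x p = 0.
  rewrite inE -leNgt => xp; apply/eqP; rewrite eq_le xp.
  by have /andP[] := xM p.
have [S0|[p0 p0S]] := set_0Vmem S.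
  exists (fun I => M * (I == Sub finset.set0 down_set0_closed)%:R); split.
  - by move=> I; rewrite mulr_ge0.
  - by rewrite (bigD1 (Sub finset.set0 down_set0_closed)) //= eqxx mulr1 big1
      ?addr0 // => I /negbTE ->; rewrite mulr0.
  - move=> p; rewrite x0 ?S0 ?inE // big1 // => I _.
    by have [->|_] := eqVneq; rewrite ?inE ?mulr0 ?mul0r.
have [p pS0 pmin] := arg_minP x p0S.
have pS : p \in S := pS0.
have dS : down_closed le S.
  by apply/down_closedP => i j ij; rewrite !inE => xj; apply: lt_le_trans xj (decr _ _ ij).
set m := x p in pmin.
have xm i : i \in S -> m <= x i by move=> /pmin.
have m0 : 0 < m by move: pS; rewrite inE.
pose y i := x i - m * (i \in S)%:R.
have [|i||i j ij|a [a0 aM aE]] := IH y (M - m).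
- rewrite -ltnS; apply: leq_trans xn; rewrite ltnS; apply/proper_card/properP; split.
    apply/fintype.subsetP => i; rewrite !inE => yi; apply: lt_le_trans yi _.
    by rewrite /y gerBl mulr_ge0 // ltW.
  exists p => //; rewrite !inE /y.
  have -> : p \in S by [].
  by rewrite mulr1 subrr ltxx.
- rewrite /y; have [iS|iS] := boolP (i \in S).
    by rewrite mulr1 subr_ge0 xm //= lerD2r; have /andP[] := xM i.
  rewrite mulr0 subr0 x0 // lexx /= subr_ge0.
  by have /andP[] := xM p.
- by rewrite subr_ge0; have /andP[] := xM p.
- rewrite /y; have [jS|jS] := boolP (j \in S).
    have /down_closedP/(_ _ _ ij jS) -> := dS.
    by rewrite lerD2r decr.
  rewrite mulr0 subr0 (x0 _ jS); have [iS|iS] := boolP (i \in S).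
    by rewrite mulr1 subr_ge0 xm.
  by rewrite mulr0 subr0 x0.
pose SS : down_set := Sub S dS.
have sumS (F : down_set -> R) : \sum_I (a I + m * (I == SS)%:R) * F I =
    \sum_I a I * F I + m * F SS.
  under eq_bigr do rewrite mulrDl; rewrite big_split /=; congr (_ + _).
  rewrite (bigD1 SS) //= eqxx mulr1 big1 ?addr0 // => I /negbTE ->.
  by rewrite mulr0 mul0r.
exists (fun I => a I + m * (I == SS)%:R); split.
- by move=> I; rewrite addr_ge0 // mulr_ge0 // ltW.
- have := sumS (fun=> 1); under eq_bigr do rewrite mulr1.
  by under [X in _ = X + _]eq_bigr do rewrite mulr1; rewrite mulr1 aM subrK.
- by move=> i; rewrite sumS -aE /= subrK.
Qed.

Definition down_set_point (I : down_set) : E :=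
  (2 *: [ffun p => (p \in val I)%:R : R^o], 1).

Definition chain_form (C : {set T}) (z : E) : R^o :=
  z.2 - alternating_sum le C z.1.

Lemma chain_form_linear C : linear (chain_form C).
Proof.
move=> k x y; rewrite /chain_form /= scalerBr addrACA -opprD; congr (_ - _).
rewrite /alternating_sum scaler_sumr -big_split /=; apply: eq_bigr => c _.
by rewrite !ffunE mulrDr mulrCA.
Qed.

Definition chain_functional (C : chain) : 'Hom(E, R^o) :=
  sval (cid (exists_hom (chain_form_linear (val C)))).

Lemma chain_functionalE C z :
  chain_functional C z = z.2 - alternating_sum le (val C) z.1.
Proof. by rewrite /chain_functional; case: cid. Qed.

(** The alternating sum of [2 1_I] along [C] is [0] or [2]. *)
Lemma chain_down_set (I : down_set) (C : chain) :
  exists s : bool, chain_functional C (down_set_point I) = (-1) ^+ s.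
Proof.
have [s sE] : exists s : bool,
    alternating_sum le (val C) (fun p => (p \in val I)%:R) = s%:R :> R.
  exact: alternating_sum_indicator (valP C) (valP I).
exists s; rewrite chain_functionalE /=.
rewrite (_ : alternating_sum _ _ _ = 2 * s%:R); first by case: (s) => /=; lra.
rewrite -sE /alternating_sum mulr_sumr; apply: eq_bigr => c _.
by rewrite !ffunE mulrCA.
Qed.

Lemma signed_down_set (i : bool * down_set) :
  (forall p, (signed down_set_point i).1 p = (-1) ^+ i.1 * (2 * (p \in val i.2)%:R)) /\
  (signed down_set_point i).2 = (-1) ^+ i.1.
Proof. by split => [p|] /=; rewrite ?ffunE // [LHS]mulr1. Qed.

Definition signed_hull (z : E) : Prop := exists p : bool * down_set -> R,
  [/\ forall i, 0 <= p i, \sum_i p i = 1 & z = \sum_i p i *: signed down_set_point i].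

Lemma sum_signed (V : nmodType) (A : finType) (F : bool * A -> V) :
  \sum_i F i = \sum_I F (true, I) + \sum_I F (false, I).
Proof.
rewrite (eq_bigr (fun i => F (i.1, i.2))) => [|[] //].
by rewrite -(pair_bigA _ (fun s I => F (s, I))) big_bool.
Qed.

(** The layers of [u] and [v] have total weights [1 + t] and [1 - t] with
[t = z.2]; halved, they are the weights of a convex combination whose last
coordinate is [t]. *)
Lemma jordan_signed_hull (z : E) (u v : T -> R) :
  (forall p q, le p q -> u q <= u p) -> (forall p q, le p q -> v q <= v p) ->
  (forall p, 0 <= u p <= 1 + z.2) -> (forall p, 0 <= v p <= 1 - z.2) ->
  -1 <= z.2 <= 1 -> (forall p, z.1 p = u p - v p) -> signed_hull z.
Proof.
move=> du dv uM vM /andP[z_ge z_le] zE.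
have [|a [a0 aM aE]] := layer_cake uM _ du; first by rewrite -lerBlDl sub0r.
have [|b [b0 bM bE]] := layer_cake vM _ dv; first by rewrite subr_ge0.
exists (fun i => (if i.1 then b i.2 else a i.2) / 2); split.
- by move=> [[] I] /=; rewrite divr_ge0.
- by rewrite sum_signed /= -!mulr_suml aM bM; lra.
rewrite [RHS]surjective_pairing [LHS]surjective_pairing; congr pair.
  apply/ffunP => p.
  rewrite (big_morph (fun y : E => y.1 p) (id1 := 0) (op1 := +%R)) ?ffunE //; last first.
    by move=> y y'; rewrite ffunE.
  rewrite sum_signed zE aE bE addrC -sumrN; congr (_ + _); apply: eq_bigr => I _.
    by rewrite ffunE (signed_down_set _).1 /= [RHS]mulrA; lra.
  by rewrite ffunE (signed_down_set _).1 /= [RHS]mulrA; lra.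
rewrite (big_morph (fun y : E => y.2) (id1 := 0) (op1 := +%R)) //.
rewrite sum_signed.
have -> : z.2 = (\sum_I a I - \sum_I b I) / 2 by rewrite aM bM; lra.
rewrite addrC mulrDl mulNr !mulr_suml -sumrN; congr (_ + _); apply: eq_bigr => I _.
  by rewrite -[RHS]/(_ * _) (signed_down_set _).2 /= mulrN1.
by rewrite -[RHS]/(_ * _) (signed_down_set _).2 mulr1.
Qed.

Lemma conv_signed_hull (A : set E) :
  (forall v, A v -> signed_hull v) -> forall z, conv_hull A z -> signed_hull z.
Proof.
move=> Ah z [n [a [v [a0 a1 Av ->]]]].
have /choice[p pP] := fun i => Ah _ (Av i).
exists (fun j => \sum_i a i * p i j); split.
- by move=> j; apply: sumr_ge0 => i _; rewrite mulr_ge0 //; have [] := pP i.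
- rewrite exchange_big /= -a1; apply: eq_bigr => i _; rewrite -mulr_sumr.
  by have [_ -> _] := pP i; rewrite mulr1.
- under [RHS]eq_bigr do rewrite scaler_suml; rewrite exchange_big /=.
  apply: eq_bigr => i _; have [_ _ ->] := pP i; rewrite scaler_sumr.
  by apply: eq_bigr => j _; rewrite scalerA.
Qed.

(** For the generators of [Q], one part of the decomposition is zero. *)
Lemma double_order_signed_hull (z : E) : Q z -> signed_hull z.
Proof.
apply: conv_signed_hull => {}z [] [x [x01 dx] <-].
  apply: (@jordan_signed_hull _ (fun p => 2 * x p) (fun=> 0)) => //=.
  - by move=> p q /dx; rewrite ler_pM2l.
  - by move=> p; have := x01 p; lra.
  - by move=> p; lra.
  - by lra.
  - by move=> p; rewrite ffunE subr0.
apply: (@jordan_signed_hull _ (fun=> 0) (fun p => 2 * x p)) => //=.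
- by move=> p q /dx; rewrite ler_pM2l.
- by move=> p; lra.
- by move=> p; have := x01 p; lra.
- by lra.
- by move=> p; rewrite ffunE sub0r -mulNr.
Qed.

Lemma signed_hull_double_order (z : E) : signed_hull z -> Q z.
Proof.
move=> [p [p0 p1 ->]]; apply: conv_hull_fin => // -[s I].
have OI : order_polytope R T le [ffun q => (q \in val I)%:R : R^o].
  split => [q|i j ij]; rewrite !ffunE; first by case: (_ \in _); rewrite ?lexx ?ler01.
  have := valP I => /down_closedP/(_ _ _ ij).
  by case: (j \in _) => [->|] //; rewrite ler0n.
case: s; [right|left]; eexists; try exact: OI.
  by rewrite /signed /down_set_point /= expr1 scaleN1r; congr pair; rewrite -scaleNr.
by rewrite /signed /= expr0 scale1r.
Qed.

Lemma signed_hull_ineq (z : E) : signed_hull z ->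
  forall C : chain, `|chain_functional C z| <= 1.
Proof.
move=> [p [p0 p1 ->]] C; rewrite functional_sum -p1.
apply: (le_trans (ler_norm_sum _ _ _)); apply: ler_sum => i _.
rewrite functionalZ; have [s ->] := chain_down_set i.2 C.
by rewrite -signr_addb normrM normrX normrN1 expr1n mulr1 ger0_norm.
Qed.

(** The inequalities for the chains above [p] are the bounds needed on the two
variations of [z.1] at [p]. *)
Lemma ineq_signed_hull (z : E) :
  (forall C : chain, `|chain_functional C z| <= 1) -> signed_hull z.
Proof.
move=> zC.
have zC' (C : {set T}) : homogeneous (comparable_rel le) C ->
    -1 <= z.2 - alternating_sum le C z.1 <= 1.
  by move=> chC; have := zC (Sub C chC); rewrite chain_functionalE ler_norml.
have ch0 : homogeneous (comparable_rel le) finset.set0.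
  by apply/homogeneousP => a b; rewrite inE.
have z2 : -1 <= z.2 <= 1 by have := zC' _ ch0; rewrite alternating_sum0 subr0.
apply: (@jordan_signed_hull _ (upper_variation le z.1)
                              (upper_variation le (fun q => - z.1 q))) => //.
- by move=> p q; apply: upper_variation_decr.
- by move=> p q; apply: upper_variation_decr.
- move=> p; rewrite upper_variation_ge0; apply: upper_variation_le => C chC _.
  by have := zC' C chC; lra.
- move=> p; rewrite upper_variation_ge0; apply: upper_variation_le => C chC _.
  by rewrite alternating_sumN; have := zC' C chC; lra.
- by move=> p; apply: upper_variation_sub.
Qed.

Lemma double_order_hull (z : E) : Q z <-> signed_hull z.
Proof. by split; [apply: double_order_signed_hull|apply: signed_hull_double_order]. Qed.

Lemma double_order_ineq (z : E) :
  Q z <-> forall C : chain, `|chain_functional C z| <= 1.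
Proof.
rewrite double_order_hull.
by split; [apply: signed_hull_ineq|apply: ineq_signed_hull].
Qed.

Lemma alternating_sum_basis (C : {set T}) (p : T) :
  alternating_sum le C (fun q => (q == p)%:R) =
  if p \in C then (-1) ^+ chain_rank le C p else 0 :> R.
Proof.
rewrite /alternating_sum; case: ifP => [pC|/negbT pC].
  rewrite (bigD1 p) //= eqxx mulr1 big1 ?addr0 // => q /andP[_ /negbTE ->].
  by rewrite mulr0.
apply: big1 => q qC; have [qp|_] := eqVneq q p; last by rewrite mulr0.
by rewrite -qp qC in pC.
Qed.

(** Chains with at most one element are enough. *)
Lemma chain_functional_sep (z : E) :
  (forall C : chain, chain_functional C z = 0) -> z = 0.
Proof.
move=> z0.
have ch0 : homogeneous (comparable_rel le) finset.set0.
  by apply/homogeneousP => a b; rewrite inE.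
have z2 : z.2 = 0.
  by have := z0 (Sub _ ch0); rewrite chain_functionalE alternating_sum0 subr0.
have z1 p : z.1 p = 0.
  have ch1 : homogeneous (comparable_rel le) [set p].
    by apply/homogeneousP => a b; rewrite !inE => /eqP -> /eqP ->; rewrite eqxx.
  have := z0 (Sub _ ch1); rewrite chain_functionalE z2 SubK -[[set p]]finset.setU0.
  rewrite alternating_sum_cons // ?inE // => [|c]; last by rewrite inE.
  by rewrite alternating_sum0 subr0 sub0r => /eqP; rewrite oppr_eq0 => /eqP.
by rewrite [z]surjective_pairing z2; congr pair; apply/ffunP => p; rewrite z1 ffunE.
Qed.

Lemma signr_natr_inj (s s' : bool) : (-1) ^+ s = (-1) ^+ s' :> R -> s = s'.
Proof. by case: s s' => [] [] //=; lra. Qed.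

Lemma signed_down_set_inj : injective (signed down_set_point).
Proof.
move=> [s I] [s' I'] e.
have ss' : s = s'.
  have := (signed_down_set (s, I)).2; rewrite e (signed_down_set _).2 /=.
  by move=> /signr_natr_inj.
rewrite -ss' in e *; congr pair; apply/val_inj/setP => p.
have := (signed_down_set (s, I)).1 p; rewrite e (signed_down_set _).1 /=.
have nz : (-1) ^+ s * 2 != 0 :> R by rewrite mulf_eq0 signr_eq0 pnatr_eq0.
rewrite !mulrA => /(mulfI nz) /eqP; rewrite eqr_nat.
by do 2!case: (_ \in _).
Qed.

Lemma signed_chain_inj : injective (signed chain_functional).
Proof.
move=> [s C] [s' C'] e.
have ev z : (-1) ^+ s * chain_functional C z = (-1) ^+ s' * chain_functional C' z.
  by rewrite -(signed_functional chain_functional (s, C)) e signed_functional.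
have ss' : s = s'.
  have := ev (0, 1); rewrite !chain_functionalE /=.
  have a0 D : alternating_sum le D (0 : {ffun T -> R^o}) = 0.
    by rewrite /alternating_sum big1 // => c _; rewrite ffunE mulr0.
  by rewrite !a0 subr0 !mulr1 => /signr_natr_inj.
rewrite -ss' in ev *; congr pair; apply/val_inj/setP => p.
have nz : (-1) ^+ s != 0 :> R by rewrite signr_eq0.
have := mulfI nz (ev ([ffun q => (q == p)%:R : R^o], 0)).
rewrite !chain_functionalE /= !sub0r => /oppr_inj.
have aE D : alternating_sum le D [ffun q => (q == p)%:R : R^o] =
    alternating_sum le D (fun q => (q == p)%:R) :> R.
  by apply: eq_bigr => q _; rewrite ffunE.
rewrite !aE !alternating_sum_basis; do 2!case: ifP => //= _.
  by move=> /eqP; rewrite signr_eq0.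
by move=> /esym/eqP; rewrite signr_eq0.
Qed.

Lemma dim_ambient : \dim (fullv : {vspace E}) = #|T|.+1.
Proof. by rewrite dimvf -[LHS]/(#|T| * 1 + 1)%N muln1 addn1. Qed.

Let ambient_pos : (0 < \dim (fullv : {vspace E}))%N.
Proof. by rewrite dim_ambient. Qed.

Lemma double_order_dimension : dimension Q = #|T|.+1.
Proof. by rewrite (two_level_dimension double_order_ineq) dim_ambient. Qed.

Lemma double_order_vertices : f_ 0 Q = (2 * #|down_set|)%N.
Proof.
exact: (two_level_vertices double_order_hull double_order_ineq
  chain_down_set chain_functional_sep signed_down_set_inj).
Qed.

Lemma double_order_facets : f_ #|T| Q = (2 * #|chain|)%N.
Proof.
have := two_level_facets double_order_hull double_order_ineq
  chain_down_set signed_chain_inj ambient_pos.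
by rewrite dim_ambient.
Qed.

Lemma double_order_cube : #|chain| = #|T|.+1 ->
  aff_isomorphic Q (cube R #|T|.+1).
Proof.
exact: (two_level_cube double_order_ineq chain_functional_sep dim_ambient).
Qed.

Lemma double_order_cross : #|down_set| = #|T|.+1 ->
  aff_isomorphic Q (cross_polytope R #|T|.+1).
Proof.
exact: (two_level_cross double_order_hull double_order_ineq chain_down_set dim_ambient).
Qed.

Lemma double_order_absorbing (v : E) : exists2 e : R, 0 < e & Q (e *: v).
Proof. exact: absorbing (signed_ineq double_order_ineq) v. Qed.

End DoubleOrderPolytope.

(** * Counting down-sets and chains *)

Section CountingDownSets.
Variables (T : finType) (le : rel T).
Hypotheses (leT_refl : reflexive le) (leT_anti : antisymmetric le).
Hypothesis leT_trans : transitive le.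

Local Notation cmp := (comparable_rel le).
Local Notation incmp := (fun x y => ~~ comparable_rel le x y).

Definition down_closure (A : {set T}) : {set T} := [set x | [exists y in A, le x y]].
Definition maximal_elements (I : {set T}) : {set T} :=
  [set x in I | [forall y in I, le x y ==> (x == y)]].

Lemma down_closureP (A : {set T}) x :
  reflect (exists2 y, y \in A & le x y) (x \in down_closure A).
Proof. by rewrite inE; apply: (iffP exists_inP). Qed.

Lemma maximal_elementsP (I : {set T}) x :
  reflect (x \in I /\ forall y, y \in I -> le x y -> x = y) (x \in maximal_elements I).
Proof.
rewrite inE; apply: (iffP andP) => -[xI h]; split => //.
  by move=> y yI xy; apply/eqP; have /forall_inP/(_ y yI)/implyP := h; apply.
by apply/forall_inP => y yI; apply/implyP => xy; apply/eqP; apply: h.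
Qed.

Lemma below_maximal (I : {set T}) x : x \in I ->
  exists2 y, y \in maximal_elements I & le x y.
Proof.
move=> xI; have xIx : (x \in I) && le x x by rewrite xI leT_refl.
pose above : pred T := fun p => (p \in I) && le x p.
have [p /andP[pI xp] pmax] := @arg_maxnP _ x above (fun p => #|[set d in I | le d p]|) xIx.
exists p => //; apply/maximal_elementsP; split => // y yI py.
apply/eqP; apply: contraT => npy.
have := pmax y; rewrite /above yI (leT_trans xp py) => /(_ isT); rewrite /= leqNgt => /negP[].
apply/proper_card/properP; split.
  by apply/fintype.subsetP => d; rewrite !inE => /andP[-> /leT_trans]; apply.
exists y; rewrite !inE yI ?leT_refl //=; apply: contra npy => yp.
by apply/eqP/leT_anti; rewrite py.
Qed.

Lemma maximal_elements_antichain I : homogeneous incmp (maximal_elements I).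
Proof.
apply/homogeneousP => x y /maximal_elementsP[xI xm] /maximal_elementsP[yI ym].
move=> xy; apply/negP => /orP[/(xm _ yI)|/(ym _ xI)] e; by rewrite e eqxx in xy.
Qed.

Lemma down_closureK : {in [pred A | homogeneous incmp A],
  cancel down_closure maximal_elements}.
Proof.
move=> A; rewrite inE => /homogeneousP antiA.
have eqA x y : x \in A -> y \in A -> le x y -> x = y.
  move=> xA yA xy; apply/eqP; apply: contraT => /(antiA _ _ xA yA).
  by rewrite /comparable_rel xy.
apply/setP => x; apply/maximal_elementsP/idP => [[/down_closureP[y yA xy] xm]|xA].
  by rewrite (xm y) //; apply/down_closureP; exists y.
split; first by apply/down_closureP; exists x.
move=> y /down_closureP[a aA ya] xy; apply: leT_anti; rewrite xy /=.
by rewrite (eqA x a) //; apply: leT_trans ya.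
Qed.

(** Antichains correspond to down-sets by down-closure, with inverse the set of
maximal elements. *)
Lemma card_down_sets :
  #|down_set_type le| = homogeneous_count incmp [set: T].
Proof.
rewrite card_sig /homogeneous_count.
rewrite -(@card_in_imset _ _ down_closure); last first.
  move=> A A'; rewrite !inE !finset.subsetT /= => hA hA' /(congr1 maximal_elements).
  by rewrite !down_closureK.
apply: eq_card => I; rewrite inE; apply/idP/imsetP => [/down_closedP dI|[A _ ->]].
  exists (maximal_elements I).
    by rewrite inE finset.subsetT maximal_elements_antichain.
  apply/setP => x; apply/idP/down_closureP => [/below_maximal //|[y]].
  by move=> /maximal_elementsP[yI _] /dI; apply.
apply/down_closedP => x y xy /down_closureP[z zA yz].
by apply/down_closureP; exists z => //; apply: leT_trans yz.
Qed.

Lemma homogeneous_countT (r : rel T) :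
  homogeneous_count r [set: T] = #|[set A : {set T} | homogeneous r A]|.
Proof. by apply: eq_card => A; rewrite !inE finset.subsetT. Qed.

Lemma card_chains : #|chain_type le| = homogeneous_count cmp [set: T].
Proof. by rewrite card_sig homogeneous_countT cardsE. Qed.

Lemma chain_order_counts : (forall x y, x != y -> cmp x y) ->
  #|chain_type le| = (2 ^ #|T|)%N /\ #|down_set_type le| = #|T|.+1.
Proof.
move=> h; rewrite card_chains card_down_sets !homogeneous_countT.
rewrite homogeneous_setT_card // homogeneous_le1_card // => x y /h ->.
by [].
Qed.

Lemma antichain_order_counts : (forall x y, x != y -> ~~ cmp x y) ->
  #|chain_type le| = #|T|.+1 /\ #|down_set_type le| = (2 ^ #|T|)%N.
Proof.
move=> h; rewrite card_chains card_down_sets !homogeneous_countT.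
by rewrite homogeneous_le1_card // homogeneous_setT_card.
Qed.

Lemma chains_down_sets_le :
  (#|chain_type le| * #|down_set_type le| <= #|T|.+1 * 2 ^ #|T|)%N.
Proof.
rewrite card_chains card_down_sets -cardsT.
by apply: clique_stable_count; apply: comparable_rel_sym.
Qed.

Lemma chains_down_sets_eq :
  (#|chain_type le| * #|down_set_type le| = #|T|.+1 * 2 ^ #|T|)%N ->
  (forall x y, x != y -> cmp x y) \/ (forall x y, x != y -> ~~ cmp x y).
Proof.
rewrite card_chains card_down_sets.
by apply: clique_stable_count_eq; apply: comparable_rel_sym.
Qed.
End CountingDownSets.

(** * Face numbers and extremal cases *)

Section FaceNumbers.
Local Open Scope ring_scope.
Variables (R : realType) (T : finType).

Lemma double_order_product (le : rel T) :
  reflexive le -> antisymmetric le -> transitive le ->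
  (f_ 0 (double_order_polytope R T le le) * f_ #|T| (double_order_polytope R T le le) =
   4 * (#|chain_type le| * #|down_set_type le|))%N.
Proof.
move=> r a t; rewrite double_order_vertices // double_order_facets //; lia.
Qed.

(** Both orders live on [T], so that both polytopes and [X] have the same
ambient dimension, as affine invariance requires. *)
Lemma f_common_model (le le' : rel T) (D k : nat) (X : set 'rV[R]_D) :
  reflexive le -> antisymmetric le -> transitive le ->
  reflexive le' -> antisymmetric le' -> transitive le' ->
  D = #|T|.+1 ->
  aff_isomorphic (double_order_polytope R T le le) X ->
  aff_isomorphic (double_order_polytope R T le' le') X ->
  f_ k (double_order_polytope R T le le) = f_ k (double_order_polytope R T le' le').
Proof.
move=> r a t r' a' t' DE iso iso'.
have dimD : \dim (fullv : {vspace 'rV[R]_D}) = #|T|.+1.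
  by rewrite dimvf -[LHS]/(1 * D)%N mul1n.
rewrite -(f_aff_isomorphic k _ _ iso) -?(f_aff_isomorphic k _ _ iso') ?dimD ?dim_ambient //.
  exact: double_order_absorbing.
exact: double_order_absorbing.
Qed.

Lemma cube_product (le : rel T) :
  reflexive le -> antisymmetric le -> transitive le ->
  aff_isomorphic (double_order_polytope R T le le) (cube R #|T|.+1) ->
  (#|chain_type le| * #|down_set_type le| = #|T|.+1 * 2 ^ #|T|)%N.
Proof.
move=> r a t iso.
have r' : reflexive (@eq_op T) by move=> x; apply: eqxx.
have a' : antisymmetric (@eq_op T) by move=> x y /andP[/eqP].
have t' : transitive (@eq_op T) by move=> y x z /eqP -> /eqP ->.
have [|ch dn] := antichain_order_counts r' a' t'.
  by move=> x y xy; rewrite /comparable_rel eq_sym orbb eq_sym.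
have iso' := double_order_cube R r' a' t' ch.
apply/eqP; rewrite -(eqn_pmul2l (isT : 0 < 4)%N) -double_order_product //.
by rewrite !(f_common_model _ r a t r' a' t' erefl iso iso') double_order_product // ch dn.
Qed.

Lemma cross_product (le : rel T) :
  reflexive le -> antisymmetric le -> transitive le ->
  aff_isomorphic (double_order_polytope R T le le) (cross_polytope R #|T|.+1) ->
  (#|chain_type le| * #|down_set_type le| = #|T|.+1 * 2 ^ #|T|)%N.
Proof.
move=> r a t iso.
pose le' : rel T := fun x y => (enum_rank x <= enum_rank y)%N.
have r' : reflexive le' by move=> x; apply: leqnn.
have a' : antisymmetric le' by move=> x y /anti_leq/val_inj/enum_rank_inj.
have t' : transitive le' by move=> y x z; apply: leq_trans.
have [|ch dn] := chain_order_counts r' a' t'.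
  by move=> x y _; apply: leq_total.
have iso' := double_order_cross R r' a' t' dn.
apply/eqP; rewrite -(eqn_pmul2l (isT : 0 < 4)%N) -double_order_product //.
by rewrite !(f_common_model _ r a t r' a' t' erefl iso iso') double_order_product //
  ch dn [(2 ^ _ * _)%N]mulnC.
Qed.
End FaceNumbers.

Theorem lemma15 (R : realType) (disp : Order.disp_t) (P : finPOrderType disp) :
  let Q := double_order_polytope R P <=%O <=%O in
  let D := dimension Q in
  (f_ 0 Q * f_ D.-1 Q <= D * 2 ^ D.+1)%N /\
  ((f_ 0 Q * f_ D.-1 Q = D * 2 ^ D.+1)%N <->
   aff_isomorphic Q (cube R D) \/ aff_isomorphic Q (cross_polytope R D)).
Proof.
move=> Q D.
have r : reflexive (<=%O : rel P) := lexx.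
have a : antisymmetric (<=%O : rel P) := @le_anti _ P.
have t : transitive (<=%O : rel P) := @le_trans _ P.
have -> : D = #|P|.+1 by apply: double_order_dimension.
rewrite double_order_product //.
have -> : (#|P|.+1 * 2 ^ #|P|.+2 = 4 * (#|P|.+1 * 2 ^ #|P|))%N.
  by rewrite !expnS; lia.
split; first by rewrite leq_pmul2l //; apply: chains_down_sets_le.
split=> [/eqP|]; last first.
  by case=> iso; congr muln; [apply: cube_product iso | apply: cross_product iso].
rewrite eqn_pmul2l // => /eqP /(chains_down_sets_eq r a t).
case=> [/(chain_order_counts r a t)[_ dn]|/(antichain_order_counts r a t)[ch _]].
  by right; apply: double_order_cross.
by left; apply: double_order_cube.
Qed.
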